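(* Let $\mathcal{G}$ be the simple graph with edges $ab, bc, ac$, a cycle of length $3$, and let $I(\mathcal{G})$ be its edge ideal. Then $I(\mathcal{G})$ is a Lyubeznik totally ideal.
   Context: $K$ is a field and $R$ is the polynomial ring over $K$ whose variables are the vertices of the graph. The edge ideal $I(\mathcal{G})\subseteq R$ is generated by the monomials $xy$ with $\{x,y\}$ an edge of $\mathcal{G}$; here $I(\mathcal{G})=\langle ab,bc,ac\rangle$. For a monomial ideal $I$, $G(I)$ is its minimal set of monomial generators. Given a total order on $G(I)=\{m_1\prec\cdots\prec m_\mu\}$, a symbol is $u(i_1;\ldots;i_t)$ with $1\le i_1<\cdots<i_t\le\mu$; it is $L$-admissible (of dimension $t$) if for all $h<t$ and all $q<i_h$, $m_q$ does not divide $\mathrm{lcm}(m_{i_h},\ldots,m_{i_t})$. The corresponding Lyubeznik resolution of $R/I$ is the free resolution with $L^0=R$, $L^t$ the free $R$-module on the $L$-admissible symbols of dimension $t$, and $$\partial_t(u(i_1;\ldots;i_t))=\sum_{j=1}^t(-1)^{j+1}\frac{\mathrm{lcm}(m_{i_1},\ldots,m_{i_t})}{\mathrm{lcm}(m_{i_1},\ldots,\widehat{m_{i_j}},\ldots,m_{i_t})}\,u(i_1;\ldots;\widehat{i_j};\ldots;i_t).$$ $I$ is a Lyubeznik totally ideal if for every total order on $G(I)$ the corresponding Lyubeznik resolution of $R/I$ is a minimal free resolution of $R/I$. *)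

(* Defs.v *)
From HB Require Import structures.
From mathcomp Require Import all_boot all_order all_algebra.
From mathcomp Require Import mpoly.

Set Implicit Arguments.
Unset Strict Implicit.
Unset Printing Implicit Defensive.

Import GRing.Theory.
Local Open Scope ring_scope.

Section Ideals.
Variable R : comNzRingType.

Definition ideal_gen (S : R -> Prop) (p : R) : Prop :=
  exists s : seq (R * R),
    (forall x, x \in s -> S x.2) /\ p = \sum_(x <- s) x.1 * x.2.

Definition same_ideal (I J : R -> Prop) : Prop := forall p, I p <-> J p.

End Ideals.

Section Resolutions.
Variable R : comNzRingType.

(* A nonnegatively graded sequence of finite free R-modules, each given with
   a basis.  [fc_aug] gives the values on the basis of F_0 of a linear map
   F_0 -> R; composed with R -> R/I it is the augmentation F_0 -> R/I (every
   R-linear map F_0 -> R/I lifts to R, since F_0 is free). *)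
Record free_complex := FreeComplex {
  fc_basis : nat -> finType;
  fc_bdry : forall t, fc_basis t.+1 -> {ffun fc_basis t -> R};
  fc_aug : fc_basis 0 -> R
}.

Variable C : free_complex.

Definition fc_mod (t : nat) := {ffun fc_basis C t -> R}.

Definition fc_diff (t : nat) (f : fc_mod t.+1) : fc_mod t :=
  [ffun v => \sum_u f u * fc_bdry u v].

Definition fc_augment (f : fc_mod 0) : R := \sum_u f u * fc_aug u.

(* Exactness of ... -> F_2 -> F_1 -> F_0 -> R/I -> 0, the three clauses being
   exactness at R/I, at F_0 and at F_(t+1). *)
Definition free_resolution_of_quotient (I : R -> Prop) : Prop :=
  [/\ forall p : R, exists f : fc_mod 0, I (p - fc_augment f),
      forall f : fc_mod 0,
        I (fc_augment f) <-> exists g : fc_mod 1, fc_diff g = f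
    & forall t (f : fc_mod t.+1),
        fc_diff f = 0 <-> exists g : fc_mod t.+2, fc_diff g = f].

(* The image of F_(t+1) is contained in mm F_t. *)
Definition minimal_complex (mm : R -> Prop) : Prop :=
  forall t (f : fc_mod t.+1) (v : fc_basis C t), mm (fc_diff f v).

End Resolutions.

Section MonomialIdeals.
Variables (n : nat) (K : fieldType).
Local Notation R := {mpoly K[n]}.
Local Notation mon := 'X_{1..n}.

Definition monomial_span (S : mon -> Prop) : R -> Prop :=
  ideal_gen (fun p : R => exists2 m, S m & p = 'X_[m]).

Definition monomial_ideal (I : R -> Prop) : Prop :=
  exists S : mon -> Prop, same_ideal I (monomial_span S).

(* G lists, without repetition, the minimal set of monomial generators of I. *)
Definition min_mon_generators (I : R -> Prop) (G : seq mon) : Prop :=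
  [/\ uniq G,
      same_ideal I (monomial_span (fun m => m \in G))
    & forall G' : seq mon, {subset G' <= G} ->
        same_ideal I (monomial_span (fun m => m \in G')) ->
        {subset G <= G'}].

Definition irrelevant_ideal : R -> Prop :=
  ideal_gen (fun p : R => exists i : 'I_n, p = 'X_i).

Definition minimal_free_resolution_of_quotient
    (C : free_complex R) (I : R -> Prop) : Prop :=
  free_resolution_of_quotient C I /\ minimal_complex C irrelevant_ideal.

End MonomialIdeals.

(* The sequence s with its entry of index j (counted from 0) removed. *)
Definition del_nth (T : Type) (j : nat) (s : seq T) : seq T :=
  take j s ++ drop j.+1 s.

Lemma size_del_nth T j (s : seq T) : (j < size s)%N ->
  size (del_nth j s) = (size s).-1.
Proof.
move=> jlt; rewrite size_cat size_take size_drop jlt.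
by apply: succn_inj; rewrite -addSn subnKC // prednK // (leq_ltn_trans _ jlt).
Qed.

Lemma size_del_tupleP T t (u : t.+1.-tuple T) (j : 'I_t.+1) :
  size (del_nth j u) == t.
Proof. by rewrite size_del_nth size_tuple. Qed.

Definition del_tuple T t (u : t.+1.-tuple T) (j : 'I_t.+1) : t.-tuple T :=
  Tuple (size_del_tupleP u j).

Lemma subseq_del_nth (T : eqType) j (s : seq T) : subseq (del_nth j s) s.
Proof.
rewrite -[X in subseq _ X](cat_take_drop j s) cat_subseq //.
by rewrite -add1n -drop_drop; exact: drop_subseq.
Qed.

Section Lyubeznik.
Variables (n : nat) (K : fieldType).
Local Notation R := {mpoly K[n]}.

(* The ordered generators m_1 < ... < m_mu, indexed here from 0. *)
Variable ms : seq 'X_{1..n}.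
Local Notation mu := (size ms).

Definition sym_lcm (s : seq 'I_mu) : 'X_{1..n} :=
  \big[@mlcm n/0%MM]_(i <- s) nth 0%MM ms i.

Definition Ladmissible (t : nat) (u : t.-tuple 'I_mu) : bool :=
  sorted (fun i j : 'I_mu => (i < j)%N) u &&
  [forall h : 'I_t, forall q : 'I_mu,
     (h.+1 < t)%N && (q < tnth u h)%N ==>
       ~~ (nth 0%MM ms q <= sym_lcm (drop h u))%MM].

Definition Lsymbol (t : nat) : finType :=
  {u : t.-tuple 'I_mu | Ladmissible u}.

Lemma sym_lcm_sub (s1 s2 : seq 'I_mu) : {subset s1 <= s2} ->
  (sym_lcm s1 <= sym_lcm s2)%MM.
Proof.
have le_mem (s : seq 'I_mu) i : i \in s -> (nth 0%MM ms i <= sym_lcm s)%MM.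
  elim: s => // x s IHs; rewrite inE /sym_lcm big_cons => /predU1P[->|/IHs le_is].
    exact: lem_mlcml.
  exact: lepm_trans le_is (lem_mlcmr _ _).
elim: s1 => [|x s1 IHs] sub12.
  by rewrite /sym_lcm big_nil; apply/mnm_lepP=> i; rewrite mnm0E.
rewrite {1}/sym_lcm big_cons lem_mlcm le_mem ?IHs // => [y ys1|].
  by rewrite sub12 // inE ys1 orbT.
by rewrite sub12 // mem_head.
Qed.

Lemma Ladmissible_del t (u : t.+1.-tuple 'I_mu) (j : 'I_t.+1) :
  Ladmissible u -> Ladmissible (del_tuple u j).
Proof.
move=> /andP[u_sorted /forallP adm_u]; apply/andP; split.
  apply: subseq_sorted u_sorted; last exact: subseq_del_nth.
  by move=> a b c; apply: ltn_trans.
apply/forallP=> h; apply/forallP=> q; apply/implyP=> /andP[ht lt_q].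
have hj : (j < size u)%N by rewrite size_tuple.
have x0 : 'I_mu := tnth u j.
have [hltj|jleh] := ltnP h j.
- have h'P : (h < t.+1)%N by apply: ltn_trans (ltn_ord h) _.
  have /forallP/(_ q)/implyP := adm_u (Ordinal h'P).
  rewrite (tnth_nth x0) /= in lt_q; rewrite (tnth_nth x0) /=.
  move: lt_q; rewrite /del_nth nth_cat size_take hj hltj nth_take // => lt_q.
  rewrite ltnS (ltnW ht) lt_q => /(_ isT); apply: contra => /lepm_trans; apply.
  apply: sym_lcm_sub; apply: mem_subseq.
  rewrite drop_cat size_take hj hltj.
  rewrite -[X in subseq _ (drop h X)](cat_take_drop j u) drop_cat size_take hj hltj.
  by rewrite cat_subseq // -add1n -drop_drop drop_subseq.
- have h'P : (h.+1 < t.+1)%N by rewrite ltnS.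
  have /forallP/(_ q)/implyP := adm_u (Ordinal h'P).
  rewrite (tnth_nth x0) /= in lt_q; rewrite (tnth_nth x0) /=.
  move: lt_q; rewrite /del_nth nth_cat size_take hj (ltnNge h j) jleh /= nth_drop.
  rewrite addSn subnKC // => lt_q.
  rewrite ltnS ht lt_q => /(_ isT).
  by rewrite drop_cat size_take hj (ltnNge h j) jleh /= drop_drop addnS subnK.
Qed.

Definition Lface t (u : Lsymbol t.+1) (j : 'I_t.+1) : Lsymbol t :=
  Sub (del_tuple (val u) j) (Ladmissible_del j (valP u)).

(* As j counts from 0, the sign (-1)^(j+1) of the 1-based convention is
   (-1)^j here.  The subtraction of exponents is the exact quotient of the two
   lcms. *)
Definition Lbdry t (u : Lsymbol t.+1) : {ffun Lsymbol t -> R} :=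
  [ffun v => \sum_(j < t.+1)
     (-1) ^+ j * 'X_[sym_lcm (val u) - sym_lcm (val (Lface u j))]
       * (v == Lface u j)%:R].

(* L^0 = R: the empty symbol is the only one of dimension 0, and it is sent
   to 1. *)
Definition lyubeznik_complex : free_complex R :=
  FreeComplex Lbdry (fun=> 1).

End Lyubeznik.

Definition total_order_on (T : eqType) (G : seq T) (le : rel T) : Prop :=
  [/\ {in G, reflexive le}, {in G &, antisymmetric le},
      {in G & &, transitive le} & {in G &, total le}].

(* [sort le G] is the listing m_1 < ... < m_mu of G in increasing order. *)
Definition lyubeznik_totally (n : nat) (K : fieldType)
    (I : {mpoly K[n]} -> Prop) : Prop :=
  monomial_ideal I /\
  forall G : seq 'X_{1..n}, min_mon_generators I G ->
  forall le : rel 'X_{1..n}, total_order_on G le ->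
    minimal_free_resolution_of_quotient (lyubeznik_complex K (sort le G)) I.

Record simple_graph (n : nat) := SimpleGraph {
  edges : {set {set 'I_n}};
  edges_card2 : forall e, e \in edges -> #|e| = 2%N
}.

Definition edge_ideal (n : nat) (K : fieldType) (g : simple_graph n) :
    {mpoly K[n]} -> Prop :=
  ideal_gen (fun p : {mpoly K[n]} =>
    exists i j : 'I_n, [set i; j] \in edges g /\ p = 'X_i * 'X_j).

Definition va : 'I_3 := @Ordinal 3 0 isT.
Definition vb : 'I_3 := @Ordinal 3 1 isT.
Definition vc : 'I_3 := @Ordinal 3 2 isT.

Definition triangle_edges : {set {set 'I_3}} :=
  [set [set va; vb]; [set vb; vc]; [set va; vc]].

Lemma triangle_edges_card2 e : e \in triangle_edges -> #|e| = 2%N.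
Proof. by rewrite !inE => /orP[/orP[]|] /eqP->; rewrite cards2. Qed.

Definition triangle : simple_graph 3 := SimpleGraph triangle_edges_card2.

(* Main.v *)
Require Import Defs.
From mathcomp Require Import all_boot all_order all_algebra.
From mathcomp Require Import mpoly.

(** The property of the triangle behind the result is that any two of the
three edge monomials [ab], [bc], [ac] have the same least common multiple
[M = abc], which is none of them.  For an ideal whose generators have this
property, every ordering [m_0 < ... < m_(mu - 1)] gives the same Lyubeznik
complex up to relabelling.  A symbol of dimension [t >= 2] is admissible only
if its entries other than the last are [0]: if [q] is smaller than such an
entry, [m_q] divides [M], which is the lcm of that entry and the last one
([ladmissible_eq0]).  So the symbols are the empty one, the [u(j)], and the
[u(0; j)] with [j > 0], and the complex is
[0 -> R^(mu - 1) -> R^mu -> R] with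
[d u(j) = m_j] and [d u(0; j) = (M / m_j) u(j) - (M / m_0) u(0)].

Exactness at [R^mu] comes from the syzygies of the [m_j]: if
[\sum_j f_j m_j = 0], then every term of [f_k m_k] is divisible by [m_k] and
by some [m_j] with [j != k], hence by [M], so [M / m_k] divides [f_k]
([syzygy_divisible]).  The quotients for [k > 0] are the coordinates of a
preimage: it agrees with [f] away from [u(0)], and the difference, a cycle
supported on [u(0)], vanishes because [R] is a domain ([exact1]).  The second
differential is injective since the coordinate of [d g] on [u(k)], [k > 0], is
[g_(0,k) M / m_k] ([exact2]).  The complex is minimal because neither
[m_j = 1] nor [m_j = M].

Generators with equal pairwise lcms none of which is one of them form an
antichain for divisibility, so they are the only minimal monomial generating
set, and every ordering of it is covered
([equal_lcms_lyubeznik_totally]). *)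

Set Implicit Arguments.
Unset Strict Implicit.
Unset Printing Implicit Defensive.

Import GRing.Theory.
Local Open Scope ring_scope.

(** * Generated ideals *)

Section IdealGen.
Variables (R : comNzRingType) (S : R -> Prop).

Lemma ideal_gen0 : ideal_gen S 0.
Proof. by exists [::]; split=> //; rewrite big_nil. Qed.

Lemma ideal_genD p q : ideal_gen S p -> ideal_gen S q -> ideal_gen S (p + q).
Proof.
move=> [s [sS ->]] [t [tS ->]]; exists (s ++ t); split; last by rewrite big_cat.
by move=> x; rewrite mem_cat => /orP[/sS|/tS].
Qed.

Lemma ideal_genMr r s : S s -> ideal_gen S (r * s).
Proof.
move=> Ss; exists [:: (r, s)]; split; last by rewrite big_seq1.
by move=> x; rewrite inE => /eqP->.
Qed.

Lemma ideal_gen_ind (P : R -> Prop) :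
  P 0 -> (forall p q, P p -> P q -> P (p + q)) ->
  (forall r s, S s -> P (r * s)) -> forall p, ideal_gen S p -> P p.
Proof.
move=> P0 PD PM p [s [sS ->]].
elim: s sS => [|x s IHs] sS; first by rewrite big_nil.
rewrite big_cons; apply: PD; first by apply/PM/sS/mem_head.
by apply: IHs => y ys; apply: sS; rewrite inE ys orbT.
Qed.

Lemma ideal_genM r p : ideal_gen S p -> ideal_gen S (r * p).
Proof.
elim/ideal_gen_ind=> [|a b ra rb|a s Ss].
  by rewrite mulr0; exact: ideal_gen0.
  by rewrite mulrDr; exact: ideal_genD.
by rewrite mulrA; exact: ideal_genMr.
Qed.

Lemma ideal_gen_sum (I : Type) (r : seq I) (P : pred I) (F : I -> R) :
  (forall i, P i -> ideal_gen S (F i)) -> ideal_gen S (\sum_(i <- r | P i) F i).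
Proof. by move=> FS; apply: big_ind; [exact: ideal_gen0|exact: ideal_genD|]. Qed.

End IdealGen.

(** * Monomial ideals *)

Section MonomialSpan.
Variables (n : nat) (K : fieldType).
Local Notation R := {mpoly K[n]}.
Local Notation mon := 'X_{1..n}.

Lemma lepm_anti (a b : mon) : (a <= b)%MM -> (b <= a)%MM -> a = b.
Proof.
move=> /mnm_lepP ab /mnm_lepP ba; apply/mnmP=> i.
by apply/eqP; rewrite eqn_leq ab ba.
Qed.

(** Membership in a monomial ideal is decided term by term: the terms of
[r * 'X_[s]] are multiples of ['X_[s]], and conversely [p] is the sum of its
terms. *)
Lemma monomial_spanP (S : mon -> Prop) (p : R) :
  monomial_span S p <->
  forall k, k \in msupp p -> exists2 s, S s & (s <= k)%MM.
Proof.
split=> [|supp_p].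
  elim/ideal_gen_ind=> [k|a b IHa IHb k|r _ [s Ss ->] k].
  - by rewrite msupp0.
  - by move/msuppD_le; rewrite mem_cat => /orP[/IHa|/IHb].
  - rewrite (perm_mem (msuppMX _ _)) => /mapP[d _ ->].
    by exists s; rewrite ?lem_addr ?lem_addl.
rewrite (mpolyE p) big_seq; apply: ideal_gen_sum => k /supp_p[s Ss le_sk].
rewrite -(submK le_sk) mpolyXD -mul_mpolyC mulrA; apply: ideal_genMr.
by exists s.
Qed.

Lemma monomial_spanX (S : mon -> Prop) (k : mon) :
  monomial_span S ('X_[k] : R) <-> exists2 s, S s & (s <= k)%MM.
Proof.
split=> [/monomial_spanP|[s Ss le_sk]]; first by apply; apply/mem_msuppXP.
by apply/monomial_spanP=> k'; rewrite msuppX inE => /eqP->; exists s.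
Qed.

Lemma mpolyX_eq0 (k : mon) : ('X_[k] == 0 :> R) = false.
Proof. by rewrite -msupp_eq0 msuppX. Qed.

Lemma mpolyX_irrelevant (k : mon) : k != 0%MM -> irrelevant_ideal ('X_[k] : R).
Proof.
move=> k0; have [i ki] : exists i, k i != 0%N.
  apply/existsP; apply: contraR k0; rewrite negb_exists => /forallP k0.
  by apply/eqP/mnmP=> i; rewrite mnm0E; apply/eqP; have := k0 i; rewrite negbK.
have le_ik : (U_(i) <= k)%MM by rewrite lep1mP.
by rewrite -(submK le_ik) mpolyXD; apply: ideal_genMr; exists i.
Qed.

(** A monomial [e] of [E] is a multiple of some [g] in [G], itself a multiple of
some [e'] in [E]; since [E] is an antichain, [e = e' = g].  So [G] contains
[E], which already generates, and minimality gives equality. *)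
Lemma min_mon_generators_antichain (I : R -> Prop) (E G : seq mon) :
  same_ideal I (monomial_span (fun m => m \in E)) ->
  {in E &, forall a b, (a <= b)%MM -> a = b} ->
  min_mon_generators I G -> G =i E.
Proof.
move=> IE antiE [_ IG minG].
have EG : {subset E <= G}.
  move=> e eE.
  have [g gG le_ge] : exists2 g, g \in G & (g <= e)%MM.
    apply: (monomial_spanX (fun s => s \in G) e).1.
    by apply/IG/IE/monomial_spanX; exists e; rewrite ?lepm_refl.
  have [e' e'E le_e'g] : exists2 e', e' \in E & (e' <= g)%MM.
    apply: (monomial_spanX (fun s => s \in E) g).1.
    by apply/IE/IG/monomial_spanX; exists g; rewrite ?lepm_refl.
  have ee' := antiE _ _ e'E eE (lepm_trans le_e'g le_ge).
  by rewrite (lepm_anti (a := e) (b := g)) // -ee'.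
by move=> g; apply/idP/idP=> [|/EG//]; apply: minG.
Qed.

End MonomialSpan.

(** * Complexes of free modules *)

Section FreeComplexes.
Variables (R : comNzRingType) (C : free_complex R).

Lemma fc_diffB t (f g : fc_mod C t.+1) : fc_diff (f - g) = fc_diff f - fc_diff g.
Proof.
apply/ffunP=> v; rewrite !ffunE -sumrB; apply: eq_bigr => u _.
by rewrite !ffunE mulrBl.
Qed.

Lemma fc_diff0 t : fc_diff (0 : fc_mod C t.+1) = 0.
Proof. by apply/ffunP=> v; rewrite !ffunE big1 // => u _; rewrite ffunE mul0r. Qed.

Lemma fc_mod_eq0 t (f : fc_mod C t) : (fc_basis C t -> False) -> f = 0.
Proof. by move=> noC; apply/ffunP=> v; case: (noC v). Qed.

End FreeComplexes.

(** * Generators with equal pairwise lcms *)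

Section EqualLcms.
Variables (n : nat) (K : fieldType) (ms : seq 'X_{1..n}) (M : 'X_{1..n}).
Local Notation R := {mpoly K[n]}.
Local Notation mu := (size ms).
Local Notation m i := (nth 0%MM ms i).
Local Notation L := (lyubeznik_complex K ms).
Local Notation sym := (Lsymbol ms).

Hypothesis lcmM : forall i j : 'I_mu, i != j -> mlcm (m i) (m j) = M.
Hypothesis m_neq0 : forall i : 'I_mu, m i != 0%MM.
Hypothesis m_neqM : forall i : 'I_mu, m i != M.

Lemma lem_m_M (i j : 'I_mu) : i != j -> (m i <= M)%MM.
Proof. by move/lcmM<-; apply: lem_mlcml. Qed.

Lemma lem_m_sym_lcm (i : 'I_mu) (s : seq 'I_mu) : i \in s -> (m i <= sym_lcm s)%MM.
Proof.
move=> si.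
have -> : m i = sym_lcm [:: i] by rewrite /sym_lcm big_cons big_nil mlcm0.
by apply: sym_lcm_sub => j; rewrite inE => /eqP->.
Qed.

Lemma lem_M_sym_lcm (i j : 'I_mu) (s : seq 'I_mu) :
  i != j -> i \in s -> j \in s -> (M <= sym_lcm s)%MM.
Proof. by move=> ij si sj; rewrite -(lcmM ij) lem_mlcm !lem_m_sym_lcm. Qed.

Lemma ladmissible_lt t (u : t.-tuple 'I_mu) (h k : 'I_t) :
  Ladmissible u -> (h < k)%N -> (tnth u h < tnth u k)%N.
Proof.
case/andP=> su _ hk; have x0 := tnth u h; rewrite !(tnth_nth x0).
apply: (sorted_ltn_nth _ _ su) => //; first by move=> a b c; apply: ltn_trans.
all: by rewrite inE size_tuple.
Qed.

(** An index [q] below an entry [i_h] that is followed by [i_k] would violate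
admissibility, as [m_q] divides [M = lcm (m_(i_h), m_(i_k))]. *)
Lemma ladmissible_eq0 t (u : t.-tuple 'I_mu) (h k : 'I_t) :
  Ladmissible u -> (h < k)%N -> tnth u h = 0%N :> nat.
Proof.
move=> adm hk; have lt_hk := ladmissible_lt adm hk.
have h1 : (h.+1 < t)%N := leq_ltn_trans hk (ltn_ord k).
apply/eqP; rewrite -leqn0 leqNgt; apply/negP=> h0.
pose q : 'I_mu := Ordinal (ltn_trans h0 (ltn_ord _)).
case/andP: (adm) => _ /forallP/(_ h)/forallP/(_ q); rewrite h1 h0 /= => /negP[].
have neq_hk : tnth u h != tnth u k by rewrite -val_eqE neq_ltn lt_hk.
have mem_drop_tnth (i : 'I_t) : (h <= i)%N -> tnth u i \in drop h u.
  move=> hi; have x0 := tnth u h.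
  rewrite (tnth_nth x0) -[in nth _ _ _](subnKC hi) -nth_drop mem_nth //.
  by rewrite size_drop size_tuple ltn_sub2r // (leq_ltn_trans hi).
apply: lepm_trans (lem_M_sym_lcm neq_hk _ _).
- by apply: (@lem_m_M q (tnth u h)); rewrite -val_eqE /= neq_ltn h0.
- exact: mem_drop_tnth.
- exact/mem_drop_tnth/ltnW.
Qed.

(** The first two entries would both be [0]. *)
Lemma no_sym3 t : sym t.+3 -> False.
Proof.
move=> [u adm].
pose h0 : 'I_t.+3 := inord 0; pose h1 : 'I_t.+3 := inord 1.
pose h2 : 'I_t.+3 := inord 2.
have h01 : (h0 < h1)%N by rewrite !inordK.
have h12 : (h1 < h2)%N by rewrite !inordK.
by have := ladmissible_lt adm h01; rewrite (ladmissible_eq0 adm h12).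
Qed.

Lemma ladmissible0 : Ladmissible (ms := ms) [tuple].
Proof. by apply/andP; split=> //; apply/forallP; case. Qed.

Definition sym0 : sym 0 := Sub [tuple] ladmissible0.

Lemma sym0E (v : sym 0) : v = sym0.
Proof. by apply: val_inj; rewrite tuple0 [RHS]tuple0. Qed.

Lemma ladmissible1 (i : 'I_mu) : Ladmissible [tuple i].
Proof. by apply/andP; split=> //; apply/forallP=> h; apply/forallP=> q; rewrite ord1. Qed.

Definition sym1 i : sym 1 := Sub [tuple i] (ladmissible1 i).

Lemma sym1_inj : injective sym1.
Proof. by move=> i j /(congr1 (fun u => thead (val u))). Qed.

Lemma sym1E (u : sym 1) : u = sym1 (tnth (val u) ord0).
Proof. by apply: val_inj; apply: eq_from_tnth => i; rewrite ord1. Qed.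

Lemma ladmissible2 (i j : 'I_mu) : i = 0%N :> nat -> j != 0%N :> nat ->
  Ladmissible [tuple i; j].
Proof.
move=> i0 j0; apply/andP; split; first by rewrite /= i0 lt0n j0.
apply/forallP=> h; apply/forallP=> q; apply/implyP=> /andP[].
by rewrite !ltnS leqn0 => /eqP h0; rewrite (tnth_nth i) h0 /= i0.
Qed.

Lemma sym2_fst (u : sym 2) : tnth (val u) ord0 = 0%N :> nat.
Proof. exact: (ladmissible_eq0 (k := ord_max) (valP u)). Qed.

Lemma sym2_neq (u : sym 2) : tnth (val u) ord0 != tnth (val u) ord_max.
Proof.
have := ladmissible_lt (h := ord0) (k := ord_max) (valP u) isT.
by rewrite -val_eqE neq_ltn => ->.
Qed.

Lemma sym2_inj (u v : sym 2) :
  tnth (val u) ord_max = tnth (val v) ord_max -> u = v.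
Proof.
move=> uv; apply: val_inj; apply: eq_from_tnth => i.
have [->//|i0] : i = ord_max \/ i = ord0.
  by case: i => [[|[|[]]]] // ?; [right|left]; apply: val_inj.
by rewrite i0; apply: val_inj; rewrite /= !sym2_fst.
Qed.

Lemma sym_lcm_sym1 (i : 'I_mu) : sym_lcm (val (sym1 i)) = m i.
Proof. by rewrite /sym_lcm big_cons big_nil mlcm0. Qed.

Lemma sym_lcm_sym2 (u : sym 2) : sym_lcm (val u) = M.
Proof.
rewrite -(lcmM (sym2_neq u)) /sym_lcm big_tuple !big_ord_recl big_ord0 mlcm0.
have -> : lift ord0 ord0 = ord_max :> 'I_2 by apply: val_inj.
by [].
Qed.

Lemma Lface1 (u : sym 2) (j : 'I_2) :
  Lface u j = sym1 (tnth (val u) (rev_ord j)).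
Proof.
apply: val_inj; apply: val_inj => /=.
case: u => [[[|a [|b []]] //= su] adm] /=.
by case: j => [[|[|[]]]] //= ?; rewrite (tnth_nth a).
Qed.

Lemma Lbdry1 (u : sym 1) (v : sym 0) : Lbdry K u v = 'X_[m (tnth (val u) ord0)].
Proof.
rewrite ffunE big_ord1 expr0 mul1r.
have -> : v = Lface u ord0 by rewrite (sym0E v) [RHS]sym0E.
rewrite eqxx mulr1 {1}(sym1E u) sym_lcm_sym1; congr 'X_[_].
apply/mnmP=> i; rewrite mnmBE [val (Lface _ _)]tuple0 /sym_lcm big_nil mnm0E.
by rewrite subn0.
Qed.

Lemma Lbdry2 (u : sym 2) (k : 'I_mu) :
  Lbdry K u (sym1 k) = 'X_[M - m k] * (k == tnth (val u) ord_max)%:R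
                     - 'X_[M - m k] * (k == tnth (val u) ord0)%:R.
Proof.
rewrite ffunE !big_ord_recl big_ord0 !Lface1 !sym_lcm_sym1 sym_lcm_sym2.
rewrite !(inj_eq sym1_inj) addr0 expr0 mul1r expr1 mulN1r mulNr.
have -> : rev_ord (lift ord0 ord0) = ord0 :> 'I_2 by apply: val_inj.
have -> : rev_ord ord0 = ord_max :> 'I_2 by apply: val_inj.
by congr (_ - _); case: eqP => [->|]; rewrite ?mulr0.
Qed.

Lemma fc_augmentE (f : fc_mod L 0) : fc_augment f = f sym0.
Proof.
rewrite /fc_augment (bigD1 sym0) //= mulr1 big1 ?addr0 // => v.
by rewrite (sym0E v) eqxx.
Qed.

Lemma diff1 (f : fc_mod L 1) (v : sym 0) :
  fc_diff f v = \sum_(i < mu) f (sym1 i) * 'X_[m i].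
Proof.
rewrite ffunE (reindex sym1) /=; first by apply: eq_bigr => i _; rewrite Lbdry1.
exists (fun u : sym 1 => tnth (val u) ord0) => [i _ //|u _].
by rewrite -sym1E.
Qed.

(** As [k] is nonzero, [u(0; k)] is the only symbol of dimension 2 whose
boundary involves [u(k)]. *)
Lemma diff2_last (g : fc_mod L 2) (u : sym 2) :
  let k := tnth (val u) ord_max in
  fc_diff g (sym1 k) = g u * 'X_[M - m k].
Proof.
move=> k; have k0 (v : sym 2) : k != tnth (val v) ord0.
  have -> : tnth (val v) ord0 = tnth (val u) ord0.
    by apply: val_inj; rewrite /= !sym2_fst.
  by rewrite eq_sym sym2_neq.
rewrite ffunE (bigD1 u) //= big1 ?addr0 => [|v vu].
  by rewrite Lbdry2 eqxx mulr1 (negPf (k0 u)) mulr0 subr0.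
rewrite Lbdry2 (negPf (k0 v)) mulr0 subr0; case: eqP => [/sym2_inj uv|_].
  by rewrite uv eqxx in vu.
by rewrite mulr0 mulr0.
Qed.

Lemma diff_diff2 (g : fc_mod L 2) : fc_diff (fc_diff g) = 0 :> fc_mod L 0.
Proof.
apply/ffunP=> v; rewrite diff1 [RHS]ffunE.
under eq_bigr do rewrite ffunE mulr_suml.
rewrite exchange_big big1 //= => u _.
under eq_bigr do rewrite -mulrA Lbdry2 -mulrBr mulrAC.
have cancelM (i j : 'I_mu) : i != j -> 'X_[M - m i] * 'X_[m i] = 'X_[M] :> R.
  by move=> ij; rewrite -mpolyXD submK // (lem_m_M ij).
set a := tnth _ ord_max; set b := tnth _ ord0.
have ba : b != a by apply: sym2_neq.
rewrite -mulr_sumr; under eq_bigr do rewrite mulrBr.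
have pick (c d : 'I_mu) : c != d ->
    \sum_(i < mu) 'X_[M - m i] * 'X_[m i] * (i == c)%:R = 'X_[M] :> R.
  move=> cd; rewrite (bigD1 c) //= eqxx mulr1 (cancelM c d) // big1 ?addr0 //.
  by move=> i /negPf->; rewrite mulr0.
by rewrite sumrB (pick b a) // (pick a b) 1?eq_sym // subrr mulr0.
Qed.

(** Each term of [f k * 'X_[m k]] also occurs in the multiples of the other
[m i], so it is divisible by [lcm (m i, m k) = M] for some [i != k]. *)
Lemma syzygy_divisible (f : 'I_mu -> R) :
  \sum_i f i * 'X_[m i] = 0 -> forall k, exists q, f k = q * 'X_[M - m k].
Proof.
move=> f0 k; have fk : f k * 'X_[m k] = - \sum_(i | i != k) f i * 'X_[m i].
  by apply/eqP; rewrite -addr_eq0; move: f0; rewrite (bigD1 k) //= => ->.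
have : monomial_span (fun s => exists2 i : 'I_mu, i != k & s = m i)
                     (f k * 'X_[m k]).
  rewrite fk -mulN1r; apply/ideal_genM/ideal_gen_sum => i ik.
  by apply: ideal_genMr; exists (m i) => //; exists i.
move/monomial_spanP=> supp_fk.
have : monomial_span (eq (M - m k)%MM) (f k).
  apply/monomial_spanP=> d df; exists (M - m k)%MM => //.
  have /supp_fk[_ [i ik ->] le_i] : (d + m k)%MM \in msupp (f k * 'X_[m k]).
    by rewrite mcoeff_msupp addmC mcoeffMX -mcoeff_msupp.
  have : (M <= d + m k)%MM by rewrite -(lcmM ik) lem_mlcm le_i lem_addl.
  move=> /mnm_lepP le_M; apply/mnm_lepP=> x.
  by rewrite mnmBE leq_subLR addnC -mnmDE.
elim/ideal_gen_ind=> [|_ _ [a ->] [b ->]|r _ [_ <- ->]].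
- by exists 0; rewrite mul0r.
- by exists (a + b); rewrite mulrDl.
- by exists r.
Qed.

(** For a cycle [f], write [f (sym1 k) = q k * 'X_[M - m k]] and send
[u(0; k)] to [q k]. *)
Lemma exact1 (f : fc_mod L 1) :
  fc_diff f = 0 <-> exists g : fc_mod L 2, fc_diff g = f.
Proof.
split=> [df|[g <-]]; last exact: diff_diff2.
have sum_f : \sum_i f (sym1 i) * 'X_[m i] = 0.
  by rewrite -(diff1 f sym0) df ffunE.
have [q fq] := fin_all_exists (syzygy_divisible sum_f).
pose g : fc_mod L 2 := [ffun u : sym 2 => q (tnth (val u) ord_max)].
exists g; apply/esym/subr0_eq; set h := f - _.
have h_last (k : 'I_mu) : k != 0%N :> nat -> h (sym1 k) = 0.
  move=> k0; pose i0 : 'I_mu := Ordinal (leq_ltn_trans (leq0n k) (ltn_ord k)).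
  have adm := ladmissible2 (erefl : i0 = 0%N :> nat) k0.
  have := diff2_last g (Sub [tuple i0; k] adm).
  by rewrite /= ffunE => dgk; rewrite !(dgk, ffunE) -fq subrr.
have sum_h : \sum_i h (sym1 i) * 'X_[m i] = 0.
  by rewrite -(diff1 h sym0) fc_diffB df diff_diff2 subr0 ffunE.
(* As [h] is supported on [u(0)], being a cycle means that its coordinate there
   has product 0 with the monomial [m 0]. *)
apply/ffunP=> u; rewrite (sym1E u) [RHS]ffunE.
have [k0|] := eqVneq (tnth (val u) ord0 : nat) 0%N; last exact: h_last.
move: sum_h; rewrite (bigD1 (tnth (val u) ord0)) //= big1 ?addr0 => [/eqP|i].
  by rewrite mulf_eq0 mpolyX_eq0 orbF => /eqP.
rewrite -val_eqE /= k0 => /h_last->.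
by rewrite mul0r.
Qed.

Lemma exact2 (f : fc_mod L 2) :
  fc_diff f = 0 <-> exists g : fc_mod L 3, fc_diff g = f.
Proof.
split=> [df|[g <-]].
  2: by rewrite (fc_mod_eq0 (C := L) g (@no_sym3 0)) !fc_diff0.
exists 0; rewrite fc_diff0; apply/ffunP=> u; rewrite ffunE.
have /eqP := diff2_last f u; rewrite df ffunE eq_sym mulf_eq0 mpolyX_eq0 orbF.
by move/eqP->.
Qed.

Lemma exact0 (I : R -> Prop) (f : fc_mod L 0) :
  same_ideal I (monomial_span (fun s => s \in ms)) ->
  I (fc_augment f) <-> exists g : fc_mod L 1, fc_diff g = f.
Proof.
move=> IE.
rewrite fc_augmentE.
split=> [/IE spanf|[g <-]]; last first.
  apply/IE; rewrite diff1; apply: ideal_gen_sum => i _; apply: ideal_genMr.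
  by exists (m i) => //; apply: mem_nth.
suff [c cE] : exists c : 'I_mu -> R, f sym0 = \sum_i c i * 'X_[m i].
  exists [ffun u : sym 1 => c (tnth (val u) ord0)]; apply/ffunP=> v.
  by rewrite (sym0E v) diff1 cE; apply: eq_bigr => i _; rewrite ffunE.
elim/ideal_gen_ind: spanf => [|_ _ [a ->] [b ->]|r _ [s sms ->]].
- by exists (fun=> 0); rewrite big1 // => i _; rewrite mul0r.
- by exists (fun i => a i + b i); rewrite -big_split; apply: eq_bigr => i _; rewrite mulrDl.
- have s_lt : (index s ms < mu)%N by rewrite index_mem.
  exists (fun i => if i == Ordinal s_lt then r else 0).
  rewrite (bigD1 (Ordinal s_lt)) //= eqxx nth_index // big1 ?addr0 // => i /negPf->.
  by rewrite mul0r.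
Qed.

(** The nonzero coefficients are, up to sign, [m j] in dimension 1 and [M / m i]
in dimension 2, none of them a unit. *)
Lemma Lbdry_irrelevant t (u : sym t.+1) (v : sym t) :
  irrelevant_ideal (Lbdry K u v).
Proof.
case: t u v => [|[|t]] u v; last by case: (no_sym3 u).
  by rewrite Lbdry1; apply: mpolyX_irrelevant.
rewrite (sym1E v) Lbdry2 -mulrBr mulrC; set i := tnth _ _; set b := _ - _.
have [->|b0] := eqVneq b 0; first by rewrite mul0r; apply: ideal_gen0.
apply/ideal_genM/mpolyX_irrelevant; apply: contraNneq (m_neqM i) => Mi.
(* A second generator is needed for [m i] to divide [M]; the pair [u] has one. *)
have [j ij] : exists j, i != j.
  have := sym2_neq u; have [->|? _] := eqVneq (tnth (val u) ord0) i.
    by exists (tnth (val u) ord_max).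
  by exists (tnth (val u) ord0); rewrite eq_sym.
by rewrite -(submK (lem_m_M ij)) Mi add0m.
Qed.

(** The hypotheses on [ms] do not mention the order of its entries, which is
what makes the result apply to every ordering of the generators. *)
Theorem lyubeznik_minimal_of_equal_lcms (I : R -> Prop) :
  same_ideal I (monomial_span (fun s => s \in ms)) ->
  minimal_free_resolution_of_quotient L I.
Proof.
move=> IE; split; last first.
  move=> t f v; rewrite ffunE; apply: ideal_gen_sum => u _.
  exact/ideal_genM/Lbdry_irrelevant.
split=> [p|f|[|[|t]] f]; [|exact: exact0|exact: exact1|exact: exact2|].
- by exists [ffun=> p]; apply/IE; rewrite fc_augmentE ffunE subrr; apply: ideal_gen0.
- have f0 : f = 0 by apply: (fc_mod_eq0 (C := L)); apply: no_sym3.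
  by rewrite f0 fc_diff0; split=> // _; exists 0; rewrite fc_diff0.
Qed.

End EqualLcms.

Theorem equal_lcms_lyubeznik_totally (n : nat) (K : fieldType)
    (E : seq 'X_{1..n}) (M : 'X_{1..n}) (I : {mpoly K[n]} -> Prop) :
  {in E &, forall a b, a != b -> mlcm a b = M} ->
  {in E, forall a, a != 0%MM} -> {in E, forall a, a != M} ->
  same_ideal I (monomial_span (fun s => s \in E)) ->
  lyubeznik_totally I.
Proof.
move=> lcmE E0 EM IE; split; first by exists (fun s => s \in E).
move=> G minG le _.
have GE : G =i E.
  apply: min_mon_generators_antichain IE _ minG => a b aE bE ab.
  apply: contraNeq (EM b bE) => /(lcmE _ _ aE bE) <-.
  by apply/eqP/lepm_anti; rewrite ?lem_mlcmr // lem_mlcm ab lepm_refl.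
have [uG IG _] := minG.
have inE (i : 'I_(size (sort le G))) : nth 0%MM (sort le G) i \in E.
  by rewrite -GE -(mem_sort le) mem_nth.
apply: (lyubeznik_minimal_of_equal_lcms (M := M)) => [i j ij|i|i|p].
- by apply: lcmE => //; rewrite nth_uniq // ?sort_uniq.
- exact: E0.
- exact: EM.
- split=> [/IG/monomial_spanP h|/monomial_spanP h].
    by apply/monomial_spanP=> k /h[s]; exists s; rewrite ?mem_sort.
  by apply/IG/monomial_spanP=> k /h[s]; rewrite mem_sort; exists s.
Qed.

(** * The triangle *)

Definition triangle_monomials : seq 'X_{1..3} :=
  [:: U_(va) + U_(vb); U_(vb) + U_(vc); U_(va) + U_(vc)]%MM.

Lemma vertex_cases (P : 'I_3 -> Prop) : P va -> P vb -> P vc -> forall i, P i.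
Proof.
by move=> Pa Pb Pc [[|[|[]]]] // lt_i; rewrite (bool_irrelevance lt_i isT).
Qed.

Lemma edge_ideal_triangle (K : fieldType) :
  same_ideal (@edge_ideal 3 K triangle)
             (monomial_span (fun s => s \in triangle_monomials)).
Proof.
move=> p; split.
  elim/ideal_gen_ind=> [|a b|r _ [i [j [ij ->]]]].
  - exact: ideal_gen0.
  - exact: ideal_genD.
  apply: ideal_genMr; exists (U_(i) + U_(j))%MM; last by rewrite mpolyXD.
  have := edges_card2 ij; rewrite cards2; case: eqVneq => // + _; rewrite !inE.
  (* Any two distinct vertices of the triangle are adjacent. *)
  by elim/vertex_cases: i {ij}; elim/vertex_cases: j => // _;
    rewrite ?eqxx ?orbT // addmC eqxx ?orbT.
elim/ideal_gen_ind=> [|a b|r _ [s sE ->]].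
- exact: ideal_gen0.
- exact: ideal_genD.
apply: ideal_genMr; move: sE; rewrite !inE => /or3P[]/eqP->;
  [exists va, vb|exists vb, vc|exists va, vc]; by rewrite mpolyXD !inE eqxx ?orbT.
Qed.

Lemma triangle_monomials_lcm :
  {in triangle_monomials &, forall a b, a != b ->
     mlcm a b = (U_(va) + U_(vb) + U_(vc))%MM}.
Proof.
move=> a b; rewrite !inE => /or3P[]/eqP-> /or3P[]/eqP->; rewrite ?eqxx // => _;
  by apply/mnmP; elim/vertex_cases; rewrite !(mnmE, mnmDE, mnm1E).
Qed.

Theorem proposition5p13 (K : fieldType) :
  lyubeznik_totally (@edge_ideal 3 K triangle).
Proof.
(* A variable absent from an edge monomial tells it from [M], and a variable
   present in it tells it from 1. *)
apply: (equal_lcms_lyubeznik_totally triangle_monomials_lcm _ _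
          (@edge_ideal_triangle K)) => a.
all: rewrite !inE => /or3P[]/eqP->; apply/eqP/mnmP.
all: try by move/(_ va); rewrite !(mnmE, mnmDE, mnm1E).
all: try by move/(_ vb); rewrite !(mnmE, mnmDE, mnm1E).
all: by move/(_ vc); rewrite !(mnmE, mnmDE, mnm1E).
Qed.
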